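(* Let $n\ge4$ be even and let $f=a_1x_1^2+\dots+a_nx_n^2$ with $a_i\in\mathbb{F}_q^\times$ such that $(-1)^{n/2}a_1\cdots a_n$ is not a square in $\mathbb{F}_q^\times$. Then for every integer $P\ge1$: if $n=4$, $$N(P)=\begin{cases}q^{2P}&\text{if }2\mid P,\\ \frac{q^2-q+1}{q}\,q^{2P}&\text{if }2\nmid P,\end{cases}$$ and if $n\ge6$, $$N(P)=\frac{q^{n/2}+1}{q^{n/2-1}+q}\,q^{P(n-2)}-(-1)^P(q-1)\frac{q^{n/2-1}-1}{q^{n/2-1}+q}\,q^{\frac n2P}.$$
   Context: $q$ is a power of an odd prime. $N(P)=\#\{\mathbf{x}\in\mathbb{F}_q[t]^n:\deg(x_i)<P\text{ for all }i,\ f(\mathbf{x})=0\}$ (with the convention $\deg 0=-\infty$, so $\mathbf{x}=\mathbf{0}$ is counted). *)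

(* Defs.v *)
From mathcomp Require Import all_boot all_order all_algebra.
Set Implicit Arguments. Unset Strict Implicit. Unset Printing Implicit Defensive.
Import Order.TTheory GRing.Theory Num.Theory.
Local Open Scope ring_scope.

Definition poly_of_row (F : finFieldType) (P : nat) (r : 'rV[F]_P) : {poly F} :=
  \sum_(j < P) r 0 j *: 'X^j.

(* N(P): number of x in F[t]^n with deg x_i < P for all i and
   a_1 x_1^2 + ... + a_n x_n^2 = 0.  Polynomials of degree < P (including 0)
   are encoded bijectively by their coefficient rows in 'rV[F]_P. *)
Definition Ncount (F : finFieldType) (n : nat) (a : 'I_n -> F) (P : nat) : nat :=
  #|[set x : {ffun 'I_n -> 'rV[F]_P} |
      \sum_(i < n) a i *: (poly_of_row (x i)) ^+ 2 == 0]|.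

(* Main.v *)
(* Let q = #|F|, m = n/2 and N = 2P - 1.  Detecting the vanishing of the N
   coefficients of f(x) with a nontrivial additive character psi of F gives
     q^N N(P) = \sum_s \prod_i \sum_(v in F^P) psi(a_i v H_s v^T),
   where s runs over F^N and H_s = (s_(i+j)) is the P x P Hankel matrix of s.
   Splitting off one square at a time, the product for H_s of rank r equals
   q^(nP) (-q^-m)^r, because \prod_i \sum_x psi(a_i x^2 / c) = -q^m for all
   c != 0, by the hypothesis on the discriminant.

   It remains to sum w^(P - rank H_s), with w = -q^m, over s.  For the b x (2P - b)
   Hankel matrices of s, the corank k_b (dimension of the left kernel) satisfies
   k_(b+1) = k_b + 1 for b < P unless k_(b+1) = 0: left kernels are spaces of
   polynomials, and a kernel K != 0 yields K + tK, which is strictly bigger than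
   K, in the next one; applied to the transposes this also bounds k_(b+1) from
   above.  Hence \sum_s w^(k_b) obeys a recursion in b with one unknown, the
   number of s with k_(b+1) = 0.  That number follows from the case w = q, in
   which \sum_s q^(k_b) counts pairs (s, u) with u in the left kernel, and can
   be evaluated by fixing u first. *)
Require Import Defs.
From mathcomp Require Import all_boot all_order all_algebra.
From mathcomp Require Import all_fingroup all_solvable all_field all_character.
From mathcomp Require Import ring zify.
Set Implicit Arguments. Unset Strict Implicit. Unset Printing Implicit Defensive.
Import Order.TTheory GRing.Theory Num.Theory.
Local Open Scope ring_scope.

(** * Ranks of Hankel matrices *)

Definition hankel (R : Type) (s : nat -> R) (b c : nat) : 'M[R]_(b, c) :=
  \matrix_(i, j) s (i + j)%N.

Lemma hankel_tr (R : Type) (s : nat -> R) b c : (hankel s b c)^T = hankel s c b.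
Proof. by apply/matrixP => i j; rewrite !mxE addnC. Qed.

Lemma mxrank_hankelC (F : fieldType) (s : nat -> F) b c :
  \rank (hankel s b c) = \rank (hankel s c b).
Proof. by rewrite -mxrank_tr hankel_tr. Qed.

(** Rows are read as polynomials in t of degree below [b]. Right multiplication by [pad_mx] only
    raises the degree bound by one; right multiplication by [shift_mx] is multiplication by t. *)
Definition pad_mx (R : pzSemiRingType) b : 'M[R]_(b, b.+1) :=
  \matrix_(i, j) (i == j :> nat)%:R.
Definition shift_mx (R : pzSemiRingType) b : 'M[R]_(b, b.+1) :=
  \matrix_(i, j) (i.+1 == j)%:R.

Lemma mul_pad_mx (R : pzSemiRingType) m b (K : 'M[R]_(m, b)) i (j : 'I_b) :
  (K *m pad_mx R b) i (widen_ord (leqnSn b) j) = K i j.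
Proof.
rewrite mxE (bigD1 j) //= mxE eqxx mulr1 big1 ?addr0 // => k /negPf nkj.
by rewrite mxE /= -[_ == _ :> nat]/(k == j) nkj mulr0.
Qed.

Lemma mul_pad_mx_max (R : pzSemiRingType) m b (K : 'M[R]_(m, b)) i :
  (K *m pad_mx R b) i ord_max = 0.
Proof. by rewrite mxE big1 // => k _; rewrite mxE /= ltn_eqF ?mulr0. Qed.

Lemma mul_shift_mx (R : pzSemiRingType) m b (K : 'M[R]_(m, b)) i (j : 'I_b) :
  (K *m shift_mx R b) i (lift ord0 j) = K i j.
Proof.
rewrite mxE (bigD1 j) //= mxE lift0 eqxx mulr1 big1 ?addr0 // => k /negPf nkj.
by rewrite mxE lift0 eqSS -[_ == _ :> nat]/(k == j) nkj mulr0.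
Qed.

(* A nonzero row space of polynomials of degree < b cannot absorb its own
   multiple by the variable: the top coefficients vanish one after the other. *)
Lemma shift_sub_pad_eq0 (F : fieldType) m b (K : 'M[F]_(m, b)) :
  (K *m shift_mx F b <= K *m pad_mx F b)%MS -> K = 0.
Proof.
case/submxP => M eqM.
suff col0 k : forall (j : 'I_b), (b - j <= k)%N -> forall i, K i j = 0.
  by apply/matrixP => i j; rewrite mxE (col0 b) ?leq_subr.
elim: k => [j|k IHk j le_k i]; first by have := ltn_ord j; lia.
rewrite -mul_shift_mx eqM.
have [j_max|j_lt] := leqP b j.+1.
  have -> : lift ord0 j = ord_max.
    by apply: ord_inj; rewrite lift0 /=; have := ltn_ord j; lia.
  by rewrite mxE big1 // => l _; rewrite mul_pad_mx_max mulr0.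
have -> : lift ord0 j = widen_ord (leqnSn b) (Ordinal j_lt).
  by apply: ord_inj; rewrite lift0.
rewrite mxE big1 // => l _; rewrite mul_pad_mx IHk ?mulr0 //=; lia.
Qed.

Lemma pad_mx_free (F : fieldType) b : row_free (pad_mx F b).
Proof.
apply/row_freeP; exists (pad_mx F b)^T; apply/matrixP => i j.
rewrite mxE (bigD1 (widen_ord (leqnSn b) i)) //= !mxE /= eqxx mul1r big1 ?addr0.
  by rewrite eq_sym.
move=> k nki; rewrite mxE -[_ == _ :> nat]/(widen_ord (leqnSn b) i == k) eq_sym.
by rewrite (negPf nki) mul0r.
Qed.

(** Both sides have entries [s (i + j)]; in [mul_shift_hankel] they have entries [s (i + j + 1)]. So
    u in the left kernel of the [b] by [c.+1] matrix puts both u and tu in that of the [b.+1] by [c]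
    matrix. *)
Lemma mul_pad_hankel (F : fieldType) (s : nat -> F) b c :
  pad_mx F b *m hankel s b.+1 c = hankel s b c.+1 *m (pad_mx F c)^T.
Proof.
apply/matrixP => i j; rewrite !mxE.
rewrite (bigD1 (widen_ord (leqnSn b) i)) //= !mxE /= eqxx mul1r.
rewrite [RHS](bigD1 (widen_ord (leqnSn c) j)) //= !mxE /= eqxx mulr1.
rewrite !big1 // => k nk; rewrite !mxE.
  by rewrite -[_ == _ :> nat]/(widen_ord (leqnSn c) j == k) eq_sym (negPf nk) mulr0.
by rewrite -[_ == _ :> nat]/(widen_ord (leqnSn b) i == k) eq_sym (negPf nk) mul0r.
Qed.

Lemma mul_shift_hankel (F : fieldType) (s : nat -> F) b c :
  shift_mx F b *m hankel s b.+1 c = hankel s b c.+1 *m (shift_mx F c)^T.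
Proof.
apply/matrixP => i j; rewrite !mxE (bigD1 (lift ord0 i)) //= !mxE lift0 eqxx mul1r.
rewrite [RHS](bigD1 (lift ord0 j)) //= !mxE !lift0 eqxx mulr1 addSnnS.
rewrite !big1 // => k nk; rewrite !mxE.
  by rewrite -[j.+1]lift0 -[_ == _ :> nat]/(lift ord0 j == k) eq_sym (negPf nk) mulr0.
by rewrite -[i.+1]lift0 -[_ == _ :> nat]/(lift ord0 i == k) eq_sym (negPf nk) mul0r.
Qed.

Lemma mxrank_hankel_le (F : fieldType) (s : nat -> F) b c :
  (\rank (hankel s b c.+1) < b)%N ->
  (\rank (hankel s b.+1 c) <= \rank (hankel s b c.+1))%N.
Proof.
move=> lt_b; set K := kermx (hankel s b c.+1).
have rK : \rank K = (b - \rank (hankel s b c.+1))%N by rewrite mxrank_ker.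
set L := (K *m pad_mx F b + K *m shift_mx F b)%MS.
have LH : L *m hankel s b.+1 c = 0.
  apply/sub_kermxP; rewrite addsmx_sub !sub_kermx -!mulmxA.
  by rewrite mul_pad_hankel mul_shift_hankel !mulmxA mulmx_ker !mul0mx eqxx.
have ltL : (\rank K < \rank L)%N.
  rewrite -(mxrankMfree K (pad_mx_free F b)) ltn_neqAle.
  have [-> ->] := mxrank_leqif_sup (addsmxSl (K *m pad_mx F b) (K *m shift_mx F b)).
  (* Equal ranks would put tK inside K, forcing K = 0 and hence rank [b]. *)
  rewrite andbT addsmx_sub submx_refl; apply/negP => /= /shift_sub_pad_eq0 K0.
  by move: rK; rewrite K0 mxrank0; lia.
have := mulmx0_rank_max LH; lia.
Qed.

(** By transposition this is [mxrank_hankel_le] for the [c] by [b.+1] matrix, whose rank is below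
    [c] unless the [b.+1] by [c] matrix has full row rank. *)
Lemma mxrank_hankel_ge (F : fieldType) (s : nat -> F) b c : (b.+1 <= c)%N ->
  (\rank (hankel s b c.+1) <= \rank (hankel s b.+1 c))%N.
Proof.
move=> le_bc; have [full|lt_b] := leqP b.+1 (\rank (hankel s b.+1 c)).
  exact: leq_trans (rank_leq_row _) (ltnW full).
rewrite (mxrank_hankelC s b) (mxrank_hankelC s b.+1); apply: mxrank_hankel_le.
rewrite mxrank_hankelC; exact: leq_trans lt_b le_bc.
Qed.

Lemma mxrank_hankel_step (F : fieldType) (s : nat -> F) b c : (b.+1 <= c)%N ->
  \rank (hankel s b.+1 c) = b.+1 \/
  \rank (hankel s b.+1 c) = \rank (hankel s b c.+1).
Proof.
move=> le_bc; have ge := mxrank_hankel_ge s le_bc.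
have := @mxrank_hankel_le F s b c.
have := rank_leq_row (hankel s b c.+1); have := rank_leq_row (hankel s b.+1 c).
case: ltnP => [_ _ _ /(_ isT)|]; last by lia.
by move=> le; right; apply/eqP; rewrite eqn_leq le ge.
Qed.

(** * Sums over Hankel matrices weighted by corank *)

Lemma sum_ker (F : finFieldType) m n (A : 'M[F]_(m, n)) :
  (\sum_(u : 'rV_m) (u *m A == 0%R) = #|F| ^ (m - \rank A))%N.
Proof.
rewrite -mxrank_ker -card_rowg -sum1_card [RHS]big_mkcond.
by apply: eq_bigr => u _; rewrite mem_rowg sub_kermx.
Qed.

(** Passing through [rVpoly] extends s by zeros to a sequence on [nat]; when b + c = N + 1 the
    indices stay below N, so the padding is never read. *)
Definition row_hankel (F : fieldType) N (s : 'rV[F]_N) b c : 'M[F]_(b, c) :=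
  hankel (fun k => (rVpoly s)`_k) b c.

(* Truncated multiplication by the polynomial [u], see [toeplitz_mul_tr]. *)
Definition toeplitz_mx (F : fieldType) N c b (u : 'rV[F]_b) : 'M[F]_(N, c) :=
  \matrix_(k, j) \sum_i u 0 i * (k == (i + j)%N :> nat)%:R.

Lemma coef_rVpoly_sum (F : fieldType) N (s : 'rV[F]_N) k :
  (rVpoly s)`_k = \sum_i s 0 i * (i == k :> nat)%:R.
Proof.
rewrite coef_rVpoly; case: insubP => [i _ <-|]; last first.
  move=> ge_k; rewrite big1 // => i _; case: eqP => [ik|_]; last by rewrite mulr0.
  by move: ge_k; rewrite -ik ltn_ord.
rewrite (bigD1 i) //= eqxx mulr1 big1 ?addr0 // => j /negPf.
by rewrite -val_eqE /= => ->; rewrite mulr0.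
Qed.

(** The kernel condition on u is linear in s as well: for fixed u, the admissible s form the left
    kernel of a Toeplitz matrix. *)
Lemma mul_row_hankel (F : fieldType) N b c (u : 'rV[F]_b) (s : 'rV[F]_N) :
  u *m row_hankel s b c = s *m toeplitz_mx N c u.
Proof.
apply/rowP => j; rewrite !mxE.
under eq_bigr do rewrite mxE coef_rVpoly_sum mulr_sumr.
rewrite exchange_big /=; apply: eq_bigr => k _; rewrite mxE mulr_sumr.
by apply: eq_bigr => i _; rewrite mulrCA.
Qed.

Lemma poly_of_rowE (F : finFieldType) P (r : 'rV[F]_P) : poly_of_row r = rVpoly r.
Proof.
apply/polyP => k; rewrite coef_rVpoly_sum coef_sum; apply: eq_bigr => i _.
by rewrite coefZ coefXn eq_sym.
Qed.

Lemma toeplitz_mul_tr (F : finFieldType) N b c (u : 'rV[F]_b) (v : 'rV[F]_c)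
    (k : 'I_N) :
  (toeplitz_mx N c u *m v^T) k 0 = (rVpoly u * rVpoly v)`_k.
Proof.
rewrite -!poly_of_rowE mulrC [poly_of_row v]/poly_of_row mulr_suml coef_sum mxE.
apply: eq_bigr => j _; rewrite !mxE [in RHS]/poly_of_row mulr_sumr coef_sum mulr_suml.
apply: eq_bigr => i _.
by rewrite -scalerAl -scalerAr !coefZ -exprD coefXn addnC mulrC.
Qed.

(** The bound on [b + c] makes truncation lossless, so injectivity is that of multiplication by a
    nonzero polynomial in a domain. *)
Lemma toeplitz_mx_rank (F : finFieldType) N c b (u : 'rV[F]_b) :
  u != 0 -> (b + c <= N.+1)%N -> \rank (toeplitz_mx N c u) = c.
Proof.
move=> nz_u le_bc; rewrite -mxrank_tr; apply/eqP; rewrite -[_ == c]/(row_free _).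
apply: inj_row_free => v v0.
have nz_pu : rVpoly u != 0.
  by apply: contraNneq nz_u => u0; rewrite -(rVpolyK u) u0 linear0.
suff: rVpoly u * rVpoly v == 0.
  by rewrite mulf_eq0 (negPf nz_pu) => /eqP v_0; rewrite -(rVpolyK v) v_0 linear0.
have sz d (w : 'rV[F]_d) : (size (rVpoly w) <= d)%N by apply: size_poly.
apply/eqP/polyP => k; rewrite coef0; have [le_k|lt_k] := leqP N k.
  apply: nth_default; apply: leq_trans (size_polyMleq _ _) _.
  rewrite -subn1 leq_subLR add1n; apply: leq_trans (leq_add (sz _ u) (sz _ v)) _.
  exact: leq_trans le_bc _.
rewrite -(toeplitz_mul_tr u v (Ordinal lt_k)).
by rewrite -[toeplitz_mx _ _ _]trmxK -trmx_mul v0 trmx0 mxE.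
Qed.

(** Double counting of pairs (s, u) with u in the left kernel: u = 0 admits all q^N rows s, any
    other u exactly q^(b-1). The outer factor q keeps b - 1 out of the exponents. *)
Lemma sum_card_ker_hankel (F : finFieldType) N b : (b <= N)%N ->
  (#|F| * \sum_(s : 'rV[F]_N) #|F| ^ (b - \rank (row_hankel s b (N.+1 - b))) =
   #|F| ^ N.+1 + (#|F| ^ b).-1 * #|F| ^ b)%N.
Proof.
move=> le_bN; set c := (N.+1 - b)%N.
under eq_bigr => s _ do rewrite -sum_ker.
rewrite exchange_big (bigD1 0) //=.
rewrite [X in (X + _)%N](eq_bigr (fun=> 1%N)) => [|s _]; last by rewrite mul0mx eqxx.
rewrite sum1_card card_mx mul1n mulnDr -expnS; congr addn; rewrite big_distrr /=.
rewrite (eq_bigr (fun=> (#|F| ^ b)%N)) => [|u nz_u].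
  by rewrite sum_nat_const cardC1 card_mx mul1n.
have b_gt0 : (0 < b)%N by case: b u nz_u {le_bN c} => // u; rewrite [u]thinmx0 eqxx.
under eq_bigr => s _ do rewrite mul_row_hankel.
rewrite sum_ker toeplitz_mx_rank //; last by rewrite /c; lia.
by rewrite -expnS; congr expn; rewrite /c; lia.
Qed.

Definition hankel_sum (F : finFieldType) (R : pzRingType) N b (w : R) : R :=
  \sum_(s : 'rV[F]_N) w ^+ (b - \rank (row_hankel s b (N.+1 - b))).

Lemma hankel_sumS (F : finFieldType) (R : comPzRingType) N b (w : R) :
  (b.+1 + b.+1 <= N.+1)%N ->
  hankel_sum F N b.+1 w = w * hankel_sum F N b w +
    (1 - w) * #|[set s : 'rV[F]_N | \rank (row_hankel s b.+1 (N - b)) == b.+1]|%:R.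
Proof.
move=> le_bN; rewrite /hankel_sum; have -> : (N.+1 - b = (N - b).+1)%N by lia.
rewrite cardsE -sum1_card natr_sum [X in _ + _ * X]big_mkcond /= !mulr_sumr.
rewrite -big_split /=.
apply: eq_bigr => s _; rewrite subSS.
have le_b : (b.+1 <= N - b)%N by lia.
have := mxrank_hankel_step (fun k => (rVpoly s)`_k) le_b.
have := @mxrank_hankel_le F (fun k => (rVpoly s)`_k) b (N - b).
rewrite -!/(row_hankel _ _ _); have := rank_leq_row (row_hankel s b (N - b).+1).
rewrite -[s \in _]/(_ == _); set r := \rank _; set r' := \rank _ => le_rb le_r'r.
case=> r'E.
  (* If [r < b], then [r'] would be at most [r]. So both coranks are 0 and the identity reads 1 = w
     + (1 - w). *)
  have -> : r = b
    by apply/eqP; rewrite eqn_leq le_rb leqNgt; apply/negP; move: le_r'r; lia.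
  by rewrite r'E eqxx !subnn expr0 !mulr1; ring.
by rewrite r'E ltn_eqF ?ltnS // mulr0 addr0 -exprS subSn.
Qed.

Lemma hankel_sum0 (F : finFieldType) (R : pzRingType) N (w : R) :
  hankel_sum F N 0 w = (#|F| ^ N)%:R.
Proof.
by rewrite /hankel_sum (eq_bigr (fun=> 1)) // sumr_const card_mx mul1n.
Qed.

Lemma hankel_sum_card (F : finFieldType) (R : pzRingType) N b : (b <= N)%N ->
  (#|F|%:R * hankel_sum F N b #|F|%:R : R) =
  (#|F| ^ N.+1 + (#|F| ^ b).-1 * #|F| ^ b)%:R.
Proof.
move=> le_bN; rewrite -sum_card_ker_hankel // natrM natr_sum.
by congr (_ * _); apply: eq_bigr => s _; rewrite natrX.
Qed.

(* The unknown number of [s] with injective Hankel matrix is eliminated between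
   the recursions for [w] and for [w = #|F|], where the sum is known. *)
Lemma hankel_sumE (F : finFieldType) (R : numFieldType) N b (w : R) :
  (b + b <= N.+1)%N -> let q : R := #|F|%:R in
  (q ^+ 2 - w) * (hankel_sum F N b w - q ^+ N) = (1 - w) * (w ^+ b - q ^+ (b + b)).
Proof.
move=> le_bN q; have q_gt1 : 1 < q by rewrite ltr1n finNzRing_gt1.
elim: b le_bN => [_|b IHb le_bN].
  by rewrite hankel_sum0 natrX !subrr !mulr0.
have le_bN1 : (b < N)%N by lia.
set z : R := #|[set s : 'rV[F]_N | \rank (row_hankel s b.+1 (N - b)) == b.+1]|%:R.
have qb1 k : ((#|F| ^ k).-1)%:R = q ^+ k - 1.
  by rewrite -subn1 natrB ?expn_gt0 ?(ltnW (finNzRing_gt1 F)) // natrX.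
(* At w = q the sums for [b] and [b.+1] are both known, so the recursion is solved for z after
   cancelling q (1 - q). *)
have zE : z = q ^+ N - q ^+ (b + b).
  have := hankel_sumS F q le_bN; rewrite -/z => /(congr1 ( *%R q)).
  rewrite mulrDr mulrCA !hankel_sum_card // ?(ltnW le_bN1) //.
  rewrite !natrD !natrM !qb1 !natrX -/q => E.
  have nz : q * (1 - q) != 0.
    by rewrite mulf_neq0 ?subr_eq0 ?[1 == q]eq_sym ?gt_eqF // (lt_trans ltr01).
  apply: (mulfI nz).
  have {}E : q * ((1 - q) * z) = q ^+ N.+1 + (q ^+ b.+1 - 1) * q ^+ b.+1
     - q * (q ^+ N.+1 + (q ^+ b - 1) * q ^+ b) by rewrite E; ring.
  by rewrite -mulrA E !exprS exprD; ring.
rewrite hankel_sumS // -/z zE addSn addnS !exprS.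
have {}IHb := IHb (leq_trans (leq_add (leqnSn b) (leqnSn b)) le_bN).
set T := hankel_sum F N b w in IHb *.
transitivity (w * ((q ^+ 2 - w) * (T - q ^+ N))
    - (q ^+ 2 - w) * (1 - w) * q ^+ (b + b)).
  by ring.
by rewrite IHb; ring.
Qed.

(** * Character sums of quadratic forms *)

Definition nontrivial_char (F : finFieldType) (psi : F -> algC) :=
  [/\ psi 0 = 1, {morph psi : x y / x + y >-> x * y} & exists x, psi x != 1].

(** The additive group is abelian and nontrivial, so it has a non-principal irreducible character,
    which is linear. *)
Lemma nontrivial_char_exists (F : finFieldType) :
  exists psi : F -> algC, nontrivial_char psi.
Proof.
set G : {group F} := [set: F]%G.
have abG : abelian G by apply: FinRing.zmod_abelian.
have [i nz_i] : exists i : Iirr G, i != 0.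
  have : (1 < #|Iirr G|)%N by rewrite card_Iirr_abelian // cardsT finNzRing_gt1.
  rewrite (cardD1 0) inE ltnS => /card_gt0P[i]; rewrite !inE andbT.
  by exists i.
have lin_i : 'chi_i \is a linear_char by apply: (char_abelianP G abG).
exists 'chi_i; split; first exact: lin_char1.
  by move=> x y; rewrite -[x + y]FinRing.zmodMgE lin_charM ?inE.
apply/existsP; apply: contraNT nz_i; rewrite -irr_eq1 negb_exists => /forallP eq1.
apply/eqP/cfunP => x; rewrite cfun1E inE; apply/eqP.
by have := eq1 x; rewrite negbK.
Qed.

(** In characteristic 2 the additive group would be a 2-group, of even order. *)
Lemma finField_two_neq0 (F : finFieldType) : odd #|F| -> (2 : F) != 0.
Proof.
move=> oddF; apply/negP => two0.
have /fin_ring_pchar_abelem/abelem_pgroup : 2%N \in [pchar F] by rewrite !inE.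
rewrite /pgroup cardsT => /p_natP[[|k] cardF].
  by have := finNzRing_gt1 F; rewrite cardF.
by rewrite cardF expnS oddM in oddF.
Qed.

Lemma sum_char_linear (F : finFieldType) (psi : F -> algC) n (c : 'cV[F]_n) :
  nontrivial_char psi ->
  \sum_(v : 'rV_n) psi ((v *m c) 0 0) = if c == 0 then #|F|%:R ^+ n else 0.
Proof.
case=> psi0 psiD [x nt_x]; have [-> | nz_c] := eqVneq c 0.
  rewrite (eq_bigr (fun=> 1)) => [|v _]; last by rewrite mulmx0 mxE.
  by rewrite sumr_const card_mx mul1n natrX.
have [i nz_ci] : exists i, c i 0 != 0.
  apply/existsP; apply: contraNT nz_c; rewrite negb_exists => /forallP c0.
  by apply/eqP/colP => i; rewrite mxE; apply/eqP; rewrite -[_ == _]negbK.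
set S := \sum_v _; have : (1 - psi x) * S = 0.
  apply/eqP; rewrite mulrBl mul1r subr_eq0 {1}/S; apply/eqP.
  (* This translation adds x to [v *m c], so the sum equals [psi x] times itself. *)
  rewrite (reindex_inj (addrI ((x / c i 0) *: delta_mx 0 i))) /= mulr_sumr.
  apply: eq_bigr => v _; rewrite mulmxDl [LHS]/= mxE psiD -scalemxAl -rowE !mxE.
  by rewrite divfK.
by move/eqP; rewrite mulf_eq0 subr_eq0 eq_sym (negPf nt_x) => /eqP.
Qed.

Lemma sum_char (F : finFieldType) (psi : F -> algC) (c : F) :
  nontrivial_char psi ->
  \sum_(x : F) psi (x * c) = if c == 0 then #|F|%:R else 0.
Proof.
move=> nt_psi; have := sum_char_linear (c%:M : 'cV[F]_1) nt_psi.
have -> : (c%:M == 0 :> 'cV[F]_1) = (c == 0)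
  by apply/eqP/eqP => [/matrixP/(_ 0 0)|->]; rewrite ?raddf0 // !mxE eqxx.
rewrite expr1 => <-.
rewrite (reindex (fun v : 'rV[F]_1 => v 0 0)) /=.
  by apply: eq_bigr => v _; rewrite mul_mx_scalar mxE mulrC.
exists (fun x => x%:M) => [v _|x _]; last by rewrite mxE eqxx.
by apply/rowP => i; rewrite ord1 mxE eqxx.
Qed.

Definition form_sum (F : finFieldType) (psi : F -> algC) n (M : 'M[F]_n) : algC :=
  \sum_(v : 'rV_n) psi ((v *m M *m v^T) 0 0).

Lemma form_mxC (R : comPzRingType) n (M : 'M[R]_n) (u v : 'rV_n) :
  M^T = M -> u *m M *m v^T = v *m M *m u^T.
Proof.
move=> symM; have -> : u *m M *m v^T = (u *m M *m v^T)^T.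
  by apply/matrixP => i j; rewrite !ord1 [in RHS]mxE.
by rewrite !trmx_mul trmxK symM mulmxA.
Qed.

(** Stands in for the squared modulus. Substituting u = x + v, the difference of the two values is x
    M x^T + 2 v M x^T, and summing over v leaves only the x in the radical of M. *)
Lemma form_sum_mulN (F : finFieldType) (psi : F -> algC) n (M : 'M[F]_n) :
  nontrivial_char psi -> (2 : F) != 0 -> M^T = M ->
  form_sum psi M * form_sum psi (- M) = #|F|%:R ^+ (n + (n - \rank M)).
Proof.
move=> nt_psi nz2 symM; have [psi0 psiD _] := nt_psi.
rewrite /form_sum big_distrlr exchange_big /=.
under eq_bigr => v _ do rewrite (reindex_inj (addIr v)) /=.
rewrite exchange_big /=.
transitivity (\sum_(x : 'rV[F]_n) #|F|%:R ^+ n * (x *m M == 0)%:R : algC).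
  apply: eq_bigr => x _.
  transitivity (psi ((x *m M *m x^T) 0 0) *
      \sum_(v : 'rV_n) psi ((v *m (2 *: (M *m x^T))) 0 0)).
    rewrite mulr_sumr; apply: eq_bigr => v _; rewrite -!psiD; congr psi.
    rewrite linearD /= !mulmxDl !mulmxDr mulmxN mulNmx -scalemxAr mulmxA.
    by rewrite (form_mxC x v symM) scaler_nat mulr2n !mxE; ring.
  have -> : \sum_(v : 'rV_n) psi ((v *m (2 *: (M *m x^T))) 0 0) =
      if x *m M == 0 then #|F|%:R ^+ n else 0.
    rewrite sum_char_linear // scaler_eq0 (negPf nz2) /=.
    have <- : (M *m x^T)^T = x *m M by rewrite trmx_mul trmxK symM.
    by rewrite trmx_eq0.
  have [xM0|_] := eqVneq; last by rewrite !mulr0.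
  by rewrite xM0 mul0mx mxE psi0 mul1r mulr1.
by rewrite -mulr_sumr -natr_sum sum_ker exprD natrX.
Qed.

(** * Quadratic Gauss sums *)

Definition gauss_sum (F : finFieldType) (psi : F -> algC) (a : F) : algC :=
  \sum_(x : F) psi (a * x ^+ 2).

Lemma form_sum_scalar (F : finFieldType) (psi : F -> algC) (a : F) :
  form_sum psi (a%:M : 'M_1) = gauss_sum psi a.
Proof.
rewrite /gauss_sum (reindex (fun v : 'rV[F]_1 => v 0 0)) /=.
  apply: eq_bigr => v _; rewrite mul_mx_scalar -scalemxAl mxE; congr (psi (_ * _)).
  by rewrite mxE big_ord1 mxE.
exists (fun x => x%:M) => [v _|x _]; last by rewrite mxE eqxx.
by apply/rowP => i; rewrite ord1 mxE eqxx.
Qed.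

Lemma gauss_sum_sqr (F : finFieldType) (psi : F -> algC) (s a : F) :
  s != 0 -> gauss_sum psi (s ^+ 2 * a) = gauss_sum psi a.
Proof.
move=> nz_s; rewrite /gauss_sum [RHS](reindex_inj (mulfI nz_s)) /=.
by apply: eq_bigr => x _; congr psi; ring.
Qed.

Lemma card_sqr_roots (F : finFieldType) (y : F) : (#|[pred x | x ^+ 2 == y]| <= 2)%N.
Proof.
have [x0 /eqP x0y|no_x] := pickP [pred x : F | x ^+ 2 == y]; last by rewrite eq_card0.
apply: leq_trans (subset_leq_card _) (card_size [:: x0; - x0]).
by apply/subsetP => x; rewrite !inE -x0y eqf_sqr.
Qed.

Lemma sum_fibers (T U : finType) (f : T -> U) :
  (\sum_y #|[pred x | f x == y]| = #|T|)%N.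
Proof.
rewrite -sum1_card (partition_big f predT) //=; apply: eq_bigr => y _.
by rewrite sum1_card.
Qed.

(* The fibres of the two maps together have at most two elements over each
   point, and exactly two on average. *)
Lemma card_sqr_nonsqr_roots (F : finFieldType) (g y : F) :
  ~ (exists x, x ^+ 2 = g) ->
  (#|[pred x | x ^+ 2 == y]| + #|[pred x | (g * x ^+ 2)%R == y]| = 2)%N.
Proof.
move=> nsq_g; have nz_g : g != 0.
  by apply/eqP => g0; case: nsq_g; exists 0; rewrite g0 expr0n.
have cardE z : #|[pred x | (g * x ^+ 2)%R == z]| = #|[pred x | x ^+ 2 == z / g]|.
  apply: eq_card => x.
  by rewrite !inE (can2_eq (mulKf nz_g) (mulVKf nz_g)) [_ / _]mulrC.
pose e z := (#|[pred x | x ^+ 2 == z]| + #|[pred x | (g * x ^+ 2)%R == z]|)%N.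
have le2 z : (e z <= 2)%N.
  rewrite /e; have [z0|nz_z] := eqVneq z 0.
    by rewrite !(@eq_card1 _ 0) // => x; rewrite !inE z0 ?mulf_eq0 ?(negPf nz_g) ?orbb.
  have [x /eqP xz|no_x] := pickP [pred x : F | x ^+ 2 == z]; last first.
    by rewrite eq_card0 // cardE add0n card_sqr_roots.
  rewrite [X in (_ + X)%N]eq_card0 ?addn0 ?card_sqr_roots // => t.
  apply/negP; rewrite !inE => /eqP tz; case: nsq_g; exists (x / t).
  have nz_t : t != 0 by apply: contraNneq nz_z => t0; rewrite -tz t0 expr0n mulr0.
  by rewrite expr_div_n xz -tz mulfK // expf_neq0.
have sum_e : (\sum_z e z = \sum_(z : F) 2)%N.
  by rewrite big_split /= !sum_fibers sum_nat_const muln2 addnn.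
have : (\sum_z (2 - e z) = 0)%N.
  by rewrite sumnB // sum_e subnn.
move/eqP; rewrite sum_nat_eq0 => /forallP/(_ y)/=; rewrite subn_eq0 => ge2.
by apply/eqP; rewrite eqn_leq le2.
Qed.

(** The values x^2 and g x^2 together cover each y twice, so the two Gauss sums add up to twice a
    full character sum, which is 0. *)
Lemma gauss_sum_nonsqr (F : finFieldType) (psi : F -> algC) (g a : F) :
  nontrivial_char psi -> a != 0 -> ~ (exists x, x ^+ 2 = g) ->
  gauss_sum psi (g * a) = - gauss_sum psi a.
Proof.
move=> nt_psi nz_a nsq_g; apply/eqP; rewrite -addr_eq0 addrC; apply/eqP.
have sumE (f : F -> F) :
    \sum_x psi (f x * a) = \sum_y #|[pred x | f x == y]|%:R * psi (y * a).
  rewrite (partition_big f predT) //=; apply: eq_bigr => y _.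
  by rewrite -sum1_card natr_sum mulr_suml; apply: eq_bigr => x /eqP->; rewrite mul1r.
rewrite /gauss_sum.
under eq_bigr => x _ do rewrite mulrC.
under [X in _ + X]eq_bigr => x _ do rewrite mulrAC.
rewrite !sumE -big_split /=.
under eq_bigr => y _ do rewrite -mulrDl -natrD card_sqr_nonsqr_roots //.
by rewrite -mulr_sumr sum_char // (negPf nz_a) mulr0.
Qed.

(** Division-free multiplicativity of the quadratic character G(a) / G(1): a square a changes
    nothing, a non-square flips the sign on both sides. *)
Lemma gauss_sum_mul (F : finFieldType) (psi : F -> algC) (a b : F) :
  nontrivial_char psi -> a != 0 -> b != 0 ->
  gauss_sum psi (a * b) * gauss_sum psi 1 = gauss_sum psi a * gauss_sum psi b.
Proof.
move=> nt_psi nz_a nz_b; rewrite -[in RHS](mulr1 a).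
have [[x /eqP xa]|nsq] := altP (@existsP _ [pred x | x ^+ 2 == a]).
  have nz_x : x != 0 by apply: contraNneq nz_a => x0; rewrite -xa x0 expr0n.
  by rewrite -xa !gauss_sum_sqr // mulrC.
have {}nsq : ~ (exists x, x ^+ 2 = a) by case=> x /eqP xa; case/existsP: nsq; exists x.
by rewrite !gauss_sum_nonsqr ?oner_neq0 // !mulNr mulrC.
Qed.

Lemma gauss_sum_mulN (F : finFieldType) (psi : F -> algC) (a : F) :
  nontrivial_char psi -> (2 : F) != 0 -> a != 0 ->
  gauss_sum psi a * gauss_sum psi (- a) = #|F|%:R.
Proof.
move=> nt_psi nz2 nz_a; rewrite -!form_sum_scalar raddfN /=.
by rewrite form_sum_mulN ?tr_scalar_mx // mxrank_unit ?unitmxE ?det_scalar1 ?unitfE.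
Qed.

Lemma finField_card_neq0 (F : finFieldType) (R : numDomainType) : #|F|%:R != 0 :> R.
Proof. by rewrite pnatr_eq0 -lt0n ltnW // finNzRing_gt1. Qed.

(** Let h(b) = G(b) / G(1) be the quadratic character. From G(1) G(-1) = q follows G(1)^2 = h(-1) q,
    so the product of the 2m sums is q^m times h of the discriminant, which is -1 on a
    non-square. *)
Lemma prod_gauss_sum (F : finFieldType) (psi : F -> algC) m (a : 'I_m.*2 -> F) :
  nontrivial_char psi -> (2 : F) != 0 -> (forall i, a i != 0) ->
  ~ (exists y, y ^+ 2 = (-1) ^+ m * \prod_i a i) ->
  \prod_i gauss_sum psi (a i) = - #|F|%:R ^+ m.
Proof.
move=> nt_psi nz2 nz_a nsq; set g := gauss_sum psi.
have gg a1 : a1 != 0 -> g a1 * g (- a1) = #|F|%:R by apply: gauss_sum_mulN.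
have nz_g1 : g 1 != 0.
  apply: contraTneq (finField_card_neq0 F algC) => g1; rewrite -(gg 1) ?oner_neq0 //.
  by rewrite g1 mul0r eqxx.
pose h b := g b / g 1.
have hM b c : b != 0 -> c != 0 -> h (b * c) = h b * h c.
  move=> nz_b nz_c; rewrite /h mulf_div -gauss_sum_mul //.
  by rewrite -/g -mulf_div divff // mulr1.
have h1 : h 1 = 1 by rewrite /h divff.
have nzN1 : (-1 : F) != 0 by rewrite oppr_eq0 oner_neq0.
have hprod (r : seq 'I_m.*2) :
    h (\prod_(i <- r) a i) = \prod_(i <- r) h (a i) /\ \prod_(i <- r) a i != 0.
  elim: r => [|i r [IH nz]]; first by rewrite !big_nil oner_neq0.
  by rewrite !big_cons hM // IH mulf_neq0.
have hexp k : h ((-1) ^+ k) = h (-1) ^+ k.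
  by elim: k => // k IH; rewrite !exprS hM ?expf_neq0 // IH.
have [hprodE nz_prod] := hprod (index_enum _).
have hdisc : h (-1) ^+ m * \prod_i h (a i) = -1.
  rewrite -hprodE -hexp -hM ?expf_neq0 // /h -[X in g X]mulr1.
  by rewrite /g gauss_sum_nonsqr ?oner_neq0 // mulNr divff.
have g1sqr : g 1 ^+ 2 = h (-1) * #|F|%:R.
  have hN : h (-1) ^+ 2 = 1 by rewrite -hexp sqrrN expr1n.
  rewrite -(gg 1) ?oner_neq0 // -[LHS]mul1r -hN /h; field.
  by [].
rewrite (eq_bigr (fun i => h (a i) * g 1)) => [|i _]; last by rewrite divfK.
rewrite big_split /= prodr_const card_ord -[X in g 1 ^+ X]mul2n exprM g1sqr.
rewrite exprMn mulrA.
by rewrite [_ * h (-1) ^+ m]mulrC hdisc mulN1r.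
Qed.

(** * Splitting off squares from a symmetric form *)

Lemma sym_form_neq0 (F : fieldType) n (M : 'M[F]_n) :
  (2 : F) != 0 -> M^T = M -> M != 0 -> exists w : 'rV_n, (w *m M *m w^T) 0 0 != 0.
Proof.
move=> nz2 symM nzM; have [i [j nz_ij]] : exists i j, M i j != 0.
  have [/existsP[i /existsP[j ?]]|] := boolP [exists i, exists j, M i j != 0].
    by exists i, j.
  move=> no; case/eqP: nzM; apply/matrixP => i j; rewrite mxE; apply/eqP.
  by apply: contraNT no => nz; apply/existsP; exists i; apply/existsP; exists j.
pose B (u v : 'rV[F]_n) := (u *m M *m v^T) 0 0; pose e k : 'rV[F]_n := delta_mx 0 k.
have Be k l : B (e k) (e l) = M k l by rewrite /B trmx_delta -rowE -colE !mxE.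
have [ii|] := eqVneq (M i i) 0; last by exists (e i); rewrite -/(B _ _) Be.
have [jj|] := eqVneq (M j j) 0; last by exists (e j); rewrite -/(B _ _) Be.
(* Both diagonal entries vanish here, so the form takes the value 2 M i j at this vector. *)
exists (e i + e j).
have -> : ((e i + e j) *m M *m (e i + e j)^T) 0 0 = M i i + M j j + 2 * M i j.
  rewrite linearD /= !mulmxDl !mulmxDr (form_mxC (e j) (e i) symM).
  by rewrite -!Be /B !mxE; ring.
by rewrite ii jj !add0r mulf_neq0.
Qed.

(** The form of M minus (v M w^T)^2 / (w M w^T), that is, M on the orthogonal complement of w,
    extended by zero along w. *)
Definition split_form (F : fieldType) n (M : 'M[F]_n) (w : 'rV_n) : 'M[F]_n :=
  M - ((w *m M *m w^T) 0 0)^-1 *: (M *m w^T *m (w *m M)).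

Lemma split_form_sym (F : fieldType) n (M : 'M[F]_n) (w : 'rV_n) :
  M^T = M -> (split_form M w)^T = split_form M w.
Proof.
by move=> symM; rewrite /split_form linearB linearZ /= !trmx_mul trmxK symM !mulmxA.
Qed.

(* Completing the square along [w], which lies in the radical of [split_form M w]. *)
Lemma form_sum_split (F : finFieldType) (psi : F -> algC) n (M : 'M[F]_n) w a :
  nontrivial_char psi -> M^T = M -> let c := (w *m M *m w^T) 0 0 in c != 0 ->
  #|F|%:R * form_sum psi (a *: M) =
  form_sum psi (a *: split_form M w) * gauss_sum psi (a / c).
Proof.
move=> nt_psi symM c nz_c; have [psi0 psiD _] := nt_psi.
set M' := split_form M w; pose l (v : 'rV_n) := (v *m M *m w^T) 0 0.
have lE v : w *m M *m v^T = (l v)%:M.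
  by rewrite (form_mxC w v symM); apply/matrixP => i j; rewrite !ord1 [RHS]mxE eqxx.
have splitE v : (v *m (a *: M) *m v^T) 0 0 =
    (v *m (a *: M') *m v^T) 0 0 + a / c * l v ^+ 2.
  have {1}-> : M = M' + c^-1 *: (M *m w^T *m (w *m M)) by rewrite subrK.
  rewrite scalerDr mulmxDr mulmxDl mxE; congr (_ + _).
  rewrite scalerA -scalemxAr -scalemxAl mxE; congr (_ * _).
  have -> : v *m (M *m w^T *m (w *m M)) *m v^T = v *m M *m w^T *m (w *m M *m v^T).
    by rewrite !mulmxA.
  by rewrite lE mul_mx_scalar mxE.
have wM' : w *m M' = 0.
  rewrite mulmxBr -/c -scalemxAr !mulmxA lE.
  by rewrite /l -/c mul_scalar_mx -scalemxAl scalerA mulVf // scale1r subrr.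
have M'w : M' *m w^T = 0.
  by apply: trmx_inj; rewrite trmx_mul trmxK (split_form_sym w symM) trmx0.
have shiftE s v : ((v + s *: w) *m (a *: M) *m (v + s *: w)^T) 0 0 =
    (v *m (a *: M') *m v^T) 0 0 + a / c * (l v + s * c) ^+ 2.
  rewrite splitE; congr (_ + a / c * _ ^+ 2).
    rewrite [(v + _)^T]linearD /= [(s *: w)^T]linearZ /= -!scalemxAr -scalemxAl mulmxDl.
    rewrite -scalemxAl wM' scaler0 addr0.
    by rewrite mulmxDr -scalemxAr -mulmxA M'w mulmx0 scaler0 addr0 scalemxAl.
  by rewrite /l !mulmxDl -!scalemxAl mxE [X in _ + X]mxE.
(* The factor q is spent on averaging over the translations by s w; for fixed v, s -> l(v) + s c is
   a bijection, so the sum over s is a Gauss sum independent of v. *)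
transitivity (\sum_(s : F) \sum_(v : 'rV[F]_n)
   psi ((v *m (a *: M') *m v^T) 0 0 + a / c * (l v + s * c) ^+ 2)).
  rewrite mulr_natl -sumr_const; apply: eq_bigr => s _.
  rewrite /form_sum (reindex_inj (addIr (s *: w))).
  by apply: eq_bigr => v _; rewrite shiftE.
rewrite exchange_big mulr_suml /=; apply: eq_bigr => v _.
under eq_bigr => s _ do rewrite psiD.
rewrite -mulr_sumr; congr (_ * _).
have inj : injective (fun s => l v + s * c) by move=> s t /addrI/(mulIf nz_c).
by rewrite /gauss_sum [RHS](reindex_inj inj).
Qed.

(** Read off from character sums: multiplying the splittings for M and -M gives q^2 q^(2n - rank M)
    = q^(2n - rank M') q, and exponents are compared. *)
Lemma split_form_rank (F : finFieldType) n (M : 'M[F]_n) w :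
  (2 : F) != 0 -> M^T = M -> (w *m M *m w^T) 0 0 != 0 ->
  \rank M = (\rank (split_form M w)).+1.
Proof.
move=> nz2 symM nz_c; have [psi nt_psi] := nontrivial_char_exists F.
set c := (w *m M *m w^T) 0 0 in nz_c *; set M' := split_form M w.
have E := form_sum_mulN nt_psi nz2 symM.
have E' := form_sum_mulN nt_psi nz2 (split_form_sym w symM).
have S1 := form_sum_split 1 nt_psi symM nz_c.
have SN := form_sum_split (-1) nt_psi symM nz_c.
rewrite -/c -/M' !scale1r !scaleN1r mulNr in E E' S1 SN.
have G := gauss_sum_mulN nt_psi nz2 (mulf_neq0 (oner_neq0 F) (invr_neq0 nz_c)).
have := congr2 ( *%R) S1 SN.
rewrite mulrACA E mulrACA E' G -expr2 -exprD -exprSr -!natrX => /eqP.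
rewrite eqr_nat eqn_exp2l ?finNzRing_gt1 // => /eqP.
have := rank_leq_row M; have := rank_leq_row M'; lia.
Qed.

(** Induction on the rank: each split trades a factor q in each of the n sums for the Gauss sum of
    a_i / c, and these multiply to K. The power of q on the left avoids division. *)
Lemma prod_form_sum (F : finFieldType) (psi : F -> algC) n P (a : 'I_n -> F)
    (K : algC) (M : 'M[F]_P) :
  nontrivial_char psi -> (2 : F) != 0 ->
  (forall c, c != 0 -> \prod_i gauss_sum psi (a i / c) = K) -> M^T = M ->
  #|F|%:R ^+ (n * \rank M) * \prod_i form_sum psi (a i *: M) =
  K ^+ \rank M * #|F|%:R ^+ (n * P).
Proof.
move=> nt_psi nz2 prodK; have [psi0 _ _] := nt_psi.
elim: {M}_.+1 {-2}M (ltnSn (\rank M)) => // r IHr M le_r symM.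
have [M0|/(sym_form_neq0 nz2 symM)[w nz_c]] := eqVneq M 0.
  rewrite M0 mxrank0 muln0 !expr0 !mul1r mulnC exprM.
  rewrite (eq_bigr (fun=> #|F|%:R ^+ P)) ?prodr_const ?card_ord // => i _.
  rewrite /form_sum (eq_bigr (fun=> 1)) ?sumr_const ?card_mx ?mul1n ?natrX // => v _.
  by rewrite scaler0 mulmx0 mul0mx mxE psi0.
have rankE := split_form_rank nz2 symM nz_c.
rewrite rankE mulnS exprD.
have IH := IHr (split_form M w); rewrite -ltnS -rankE in IH.
have {}IH := IH le_r (split_form_sym w symM).
rewrite [in RHS]exprS -[RHS]mulrA -[LHS]mulrA -IH -(prodK _ nz_c).
rewrite mulrCA [RHS]mulrCA; congr (_ * _).
rewrite -[X in _ ^+ X](card_ord n) -prodr_const -!big_split /=; apply: eq_bigr => i _.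
by rewrite (form_sum_split _ nt_psi symM nz_c) mulrC.
Qed.

(** * Counting *)

Lemma Ncount_char (F : finFieldType) (psi : F -> algC) n (a : 'I_n -> F) P N :
  nontrivial_char psi -> N.+1 = (P + P)%N ->
  #|F|%:R ^+ N * (Ncount a P)%:R =
  \sum_(s : 'rV[F]_N) \prod_i form_sum psi (a i *: row_hankel s P P).
Proof.
move=> nt_psi N2P; have [psi0 psiD _] := nt_psi.
pose p (x : {ffun 'I_n -> 'rV[F]_P}) := \sum_(i < n) a i *: poly_of_row (x i) ^+ 2.
pose c x : 'cV[F]_N := \col_k (p x)`_k.
(* The form has degree at most 2P - 2, so its first N = 2P - 1 coefficients are all of them. *)
have c0 x : (c x == 0) = (p x == 0).
  apply/eqP/eqP => [cx0|px0]; last by apply/colP => k; rewrite !mxE px0 coef0.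
  apply/polyP => k; rewrite coef0; have [le_k|lt_k] := leqP N k; last first.
    by have /colP/(_ (Ordinal lt_k)) := cx0; rewrite !mxE.
  rewrite /p coef_sum big1 // => i _; rewrite coefZ nth_default ?mulr0 //.
  apply: leq_trans le_k; rewrite poly_of_rowE expr2.
  apply: leq_trans (size_polyMleq _ _) _.
  have : (size (rVpoly (x i)) <= P)%N by apply: size_poly.
  by lia.
have cE x s : (s *m c x) 0 0 = \sum_i (x i *m (a i *: row_hankel s P P) *m (x i)^T) 0 0.
  transitivity ((\sum_i a i *: (s *m (toeplitz_mx N P (x i) *m (x i)^T))) 0 0).
    congr (_ 0 0); under eq_bigr => i _ do rewrite scalemxAr.
    rewrite -mulmx_sumr; congr (_ *m _); apply/colP => k.
    rewrite mxE coef_sum summxE; apply: eq_bigr => i _.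
    by rewrite coefZ mxE toeplitz_mul_tr poly_of_rowE expr2.
  rewrite summxE; apply: eq_bigr => i _.
  by rewrite mulmxA -mul_row_hankel -scalemxAr -scalemxAl.
have psi_sum (I : finType) (f : I -> F) : psi (\sum_i f i) = \prod_i psi (f i).
  exact: (big_morph psi psiD psi0).
under [RHS]eq_bigr => s _ do rewrite bigA_distr_bigA.
rewrite exchange_big /= /Ncount -sum1_card natr_sum mulr_sumr big_mkcond /=.
apply: eq_bigr => x _; rewrite inE -/(p x) -c0.
under eq_bigr => s _ do rewrite -psi_sum -cE.
by rewrite sum_char_linear // mulr1.
Qed.

Lemma Ncount_hankel_sum (F : finFieldType) m (a : 'I_m.*2 -> F) P N :
  (2 : F) != 0 -> (forall i, a i != 0) ->
  ~ (exists y, y ^+ 2 = (-1) ^+ m * \prod_i a i) -> N.+1 = (P + P)%N ->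
  let q : algC := #|F|%:R in let w := - q ^+ m in
  w ^+ P * (q ^+ N * (Ncount a P)%:R) = q ^+ (m.*2 * P) * hankel_sum F N P w.
Proof.
move=> nz2 nz_a nsq N2P q w; have [psi nt_psi] := nontrivial_char_exists F.
rewrite (Ncount_char a nt_psi N2P) /hankel_sum !mulr_sumr; apply: eq_bigr => s _.
have -> : (N.+1 - P = P)%N by rewrite N2P addnK.
set M := row_hankel s P P; have symM : M^T = M by apply: hankel_tr.
have prodK c : c != 0 -> \prod_i gauss_sum psi (a i / c) = w.
  move=> nz_c; apply: prod_gauss_sum => // [i|[y yE]].
    by rewrite mulf_neq0 ?invr_eq0.
  (* Dividing the 2m coefficients by c divides the discriminant by the square c^(2m). *)
  case: nsq; exists (y * c ^+ m); rewrite exprMn yE big_split /= prodr_const card_ord.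
  by rewrite -exprM muln2 -!mulrA exprVn mulVf ?mulr1 // expf_neq0.
have := prod_form_sum nt_psi nz2 prodK symM.
have nz_q : q != 0 by apply: finField_card_neq0.
have nz_w : w != 0 by rewrite oppr_eq0 expf_neq0.
(* As w^2 = q^(2m), one factor w^r cancels in [prod_form_sum]; the other turns w^P into w^(P -
   r). *)
have wE : #|F|%:R ^+ (m.*2 * \rank M) = w ^+ \rank M * w ^+ \rank M :> algC.
  by rewrite -exprMn -expr2 sqrrN -!exprM; congr (_ ^+ _); lia.
rewrite wE -mulrA => /(mulfI (expf_neq0 _ nz_w)) E.
rewrite -[X in w ^+ X * _](subnK (rank_leq_row M)) exprD -mulrA E mulrC //.
Qed.

(** Common form of both cases, with n = 2(k + 1). The factor q^k + q comes from q^2 - w = q (q^k +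
    q) in [hankel_sumE]. The computation takes place in [algC], where the characters live, and
    descends along the injective [ratr]. *)
Lemma Ncount_mul (F : finFieldType) k (a : 'I_k.+1.*2 -> F) P :
  (2 : F) != 0 -> (forall i, a i != 0) ->
  ~ (exists y, y ^+ 2 = (-1) ^+ k.+1 * \prod_i a i) -> (0 < P)%N ->
  let q : rat := #|F|%:R in
  (Ncount a P)%:R * (q ^+ k + q) = (q ^+ k.+1 + 1) * q ^+ (k.*2 * P)
    - (-1) ^+ P * (q - 1) * (q ^+ k - 1) * q ^+ (k.+1 * P).
Proof.
move=> nz2 nz_a nsq P_gt0 q; apply: (fmorph_inj (ratr : rat -> algC)).
rewrite !(rmorphM, rmorphB, rmorphD, rmorphXn, rmorphN, rmorph1) /= !rmorph_nat.
set Q : algC := #|F|%:R.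
have nz_Q : Q != 0 by apply: finField_card_neq0.
have [N N2P] : exists N, N.+1 = (P + P)%N by exists (P + P).-1; lia.
have := Ncount_hankel_sum nz2 nz_a nsq N2P; rewrite -/Q /=.
have := @hankel_sumE F algC N P (- Q ^+ k.+1); rewrite N2P leqnn -/Q => /(_ isT).
set T := hankel_sum _ _ _ _; set C := (Ncount a P)%:R.
have QN : Q ^+ N = Q ^+ P * Q ^+ P / Q.
  by rewrite -exprD -N2P exprSr mulfK.
rewrite /= [(- _) ^+ P]exprNn QN [(k.+1).*2]doubleS -!muln2 !mulSn !exprD.
rewrite mulnAC !exprM !exprS exprMn !expr0 !mulr1.
set A := Q ^+ k; set X := Q ^+ P; set e := (-1) ^+ P.
set Y := A ^+ P => E1 E2.
have nz_X : X != 0 by rewrite expf_neq0.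
have nz_Y : Y != 0 by rewrite !expf_neq0.
have ee : e * e = 1 by rewrite -expr2 sqrr_sign.
have XC : X * C = e * Y * Q * T.
  have nz_f : X * X * Y / Q != 0 by rewrite !mulf_neq0 ?invr_eq0.
  apply: (mulfI nz_f); transitivity (e * (e * (X * Y) * (X * X / Q * C))).
    by rewrite -[LHS]mul1r -ee; ring.
  by rewrite E2; field.
apply: (mulfI nz_X); rewrite [LHS]mulrA XC.
(* Isolates the left-hand side of [hankel_sumE], whose factor Q^2 + Q A is Q times the cleared
   denominator. *)
transitivity (e * Y * ((Q * Q - - (Q * A)) * (T - X * X / Q) + (Q + A) * (X * X))).
  by field.
rewrite E1; transitivity (e * e * (X * Y * Y * (1 + Q * A))
    + e * Y * X * X * (Q - 1) * (1 - A)).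
  by ring.
by rewrite ee; ring.
Qed.

Theorem theorem5p6 (F : finFieldType) (n : nat) (a : 'I_n -> F) :
  odd #|F| ->
  ~~ odd n -> (4 <= n)%N ->
  (forall i, a i != 0) ->
  ~ (exists y : F, y ^+ 2 = (-1) ^+ (n %/ 2) * \prod_(i < n) a i) ->
  forall P : nat, (1 <= P)%N ->
  let q : rat := (#|F|)%:R in
  (n = 4%N ->
     (Ncount a P)%:R =
       (if ~~ odd P then q ^+ (2 * P)
        else (q ^+ 2 - q + 1) / q * q ^+ (2 * P))) /\
  ((6 <= n)%N ->
     (Ncount a P)%:R =
       (q ^+ (n %/ 2) + 1) / (q ^+ (n %/ 2 - 1) + q) * q ^+ (P * (n - 2))
       - (-1) ^+ P * (q - 1) * (q ^+ (n %/ 2 - 1) - 1) / (q ^+ (n %/ 2 - 1) + q)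
         * q ^+ (n %/ 2 * P)).
Proof.
move=> oddF even_n ge4 nz_a nsq P P_gt0 q.
have [k nE] : exists k, n = k.+1.*2 by exists n./2.-1; lia.
subst n; rewrite divn2 doubleK in nsq *; rewrite subn1 /=.
have q_gt0 : 0 < q by rewrite ltr0n ltnW // finNzRing_gt1.
have nz_d : q ^+ k + q != 0 by rewrite gt_eqF // addr_gt0 ?exprn_gt0.
have nz_q : q != 0 by rewrite gt_eqF.
have {}E := Ncount_mul (finField_two_neq0 oddF) nz_a nsq P_gt0.
rewrite /= -/q in E; split=> [n4|_]; apply: (mulIf nz_d); rewrite {}E.
  have -> : k = 1%N by lia.
  (* For k = 1 both powers are q^(2P), and their coefficient is 2q for even P and 2(q^2 - q + 1) for
     odd P, against the denominator 2q. *)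
  rewrite expr1 -signr_odd; case: (odd P) => /=; field => //.
have -> : (P * (k.+1.*2 - 2) = k.*2 * P)%N by rewrite mulnC doubleS subn2.
by field.
Qed.
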